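(* The following six mesh patterns $(12,R)$ are pairwise equidistributed, where $R$ ranges over: $\{(1,2),(0,1),(1,1),(2,1),(0,0)\}$, $\{(1,2),(2,2),(0,1),(1,1),(1,0)\}$, $\{(2,2),(0,1),(1,1),(2,1),(1,0)\}$, $\{(1,2),(1,1),(2,1),(0,0),(1,0)\}$, $\{(2,2),(0,1),(1,1),(2,1),(0,0)\}$, $\{(1,2),(2,2),(1,1),(0,0),(1,0)\}$.
   Context: For $R\subseteq\{0,1,2\}^2$ and $\pi=\pi_1\cdots\pi_n\in S_n$, an occurrence of the mesh pattern $(12,R)$ in $\pi$ is a pair of positions $i_1<i_2$ with $\pi_{i_1}<\pi_{i_2}$ such that, setting $x_0=0,x_1=i_1,x_2=i_2,x_3=n+1$ and $y_0=0,y_1=\pi_{i_1},y_2=\pi_{i_2},y_3=n+1$, for every $(a,b)\in R$ there is no index $k$ with $x_a<k<x_{a+1}$ and $y_b<\pi_k<y_{b+1}$. $s_{n,k}(p)$ is the number of $\pi\in S_n$ with exactly $k$ occurrences of $p$; $p_1,p_2$ are equidistributed if $s_{n,k}(p_1)=s_{n,k}(p_2)$ for all $n,k\ge 0$. *)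

(* Defs.v *)
From mathcomp Require Import all_boot all_fingroup.

Set Implicit Arguments.
Unset Strict Implicit.
Unset Printing Implicit Defensive.

(* A shading is a subset of {0,1,2}^2.  [shading s] is the one whose boxes
   (a, b) are listed in [s], with a the column and b the row. *)
Definition shading (s : seq (nat * nat)) : {set 'I_3 * 'I_3} :=
  [set c | (nat_of_ord c.1, nat_of_ord c.2) \in s].

(* The sequence 0, u, v, n + 1 of grid lines. *)
Definition grid (n u v a : nat) : nat := nth 0 [:: 0; u; v; n.+1] a.

(* Elements of 'I_n are numbered from 0, whereas positions and values run
   over 1, ..., n: hence the successors on positions and values. *)
Definition pos (n : nat) (i : 'I_n) : nat := i.+1.
Definition value (n : nat) (p : 'S_n) (i : 'I_n) : nat := (p i).+1.

Definition in_box (n : nat) (p : 'S_n) (i1 i2 : 'I_n) (c : 'I_3 * 'I_3)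
    (k : 'I_n) : bool :=
  let x := grid n (pos i1) (pos i2) in
  let y := grid n (value p i1) (value p i2) in
  (x c.1 < pos k < x (c.1).+1) && (y c.2 < value p k < y (c.2).+1).

Definition occurrence12 (R : {set 'I_3 * 'I_3}) (n : nat) (p : 'S_n)
    (i1 i2 : 'I_n) : bool :=
  [&& pos i1 < pos i2, value p i1 < value p i2 &
      [forall c in R, ~~ [exists k : 'I_n, in_box p i1 i2 c k]]].

Definition num_occurrences12 (R : {set 'I_3 * 'I_3}) (n : nat) (p : 'S_n)
    : nat :=
  #|[set i : 'I_n * 'I_n | occurrence12 R p i.1 i.2]|.

Definition num_perms12 (R : {set 'I_3 * 'I_3}) (n k : nat) : nat :=
  #|[set p : 'S_n | num_occurrences12 R p == k]|.

Definition equidistributed12 (R1 R2 : {set 'I_3 * 'I_3}) : Prop :=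
  forall n k : nat, num_perms12 R1 n k = num_perms12 R2 n k.

(* Main.v *)
Require Import Defs.
From mathcomp Require Import all_boot all_fingroup.
From mathcomp Require Import zify.

Set Implicit Arguments.
Unset Strict Implicit.
Unset Printing Implicit Defensive.

(** Inversion and the reverse-complement of permutations transpose and rotate a
    shading, which leaves two classes, represented by [low_shading] and
    [high_shading].  Both shade the whole middle column and the box (0, 0), so
    an occurrence is a pair of adjacent entries x, h with x a left-to-right
    minimum and h > x.  Among the entries after x that exceed x, h has to be the
    least one for [low_shading] and the greatest one for [high_shading].

    Write the permutation from left to right, remembering only how many entries
    remain, how many of these are below the running minimum, and whether the
    last entry was a left-to-right minimum.  After a left-to-right minimum
    exactly one of the larger remaining entries (if there are any) completes an
    occurrence, and the state that follows does not depend on which of the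
    larger entries is chosen.  So both statistics satisfy the same recursion. *)

(** * Symmetries of shadings: inversion and reverse-complement *)

Definition transpose (R : {set 'I_3 * 'I_3}) : {set 'I_3 * 'I_3} :=
  [set c | (c.2, c.1) \in R].

Definition rotate (R : {set 'I_3 * 'I_3}) : {set 'I_3 * 'I_3} :=
  [set c | (rev_ord c.1, rev_ord c.2) \in R].

(** Inversion exchanges positions with values, hence the two families of grid lines and the two
    coordinates of each box. *)
Lemma occurrence12_transpose R n (p : 'S_n) i1 i2 :
  occurrence12 (transpose R) p^-1 (p i1) (p i2) = occurrence12 R p i1 i2.
Proof.
have box c k : in_box p^-1 (p i1) (p i2) (c.2, c.1) (p k) = in_box p i1 i2 c k.
  by rewrite /in_box /value !permK andbC.
rewrite /occurrence12 /pos /value !permK andbA [X in X && _]andbC -andbA.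
congr [&& _, _ & _].
apply/forall_inP/forall_inP => H c cR.
- apply/existsPn => k; rewrite -box.
  by move/existsPn: (H (c.2, c.1) ltac:(by rewrite inE /= -surjective_pairing)).
- rewrite inE in cR; apply/existsPn => k; rewrite -[k](permKV p).
  rewrite [c]surjective_pairing (box (c.2, c.1)).
  by move/existsPn: (H _ cR).
Qed.

Lemma equidistributed12_transpose R : equidistributed12 R (transpose R).
Proof.
move=> n k; rewrite /num_perms12 -(card_imset _ (@invg_inj 'S_n)).
apply: eq_card => q; rewrite inE -[q]invgK mem_imset; last exact: invg_inj.
rewrite inE; congr (_ == k); set p := q^-1%g.
pose f (i : 'I_n * 'I_n) := (p i.1, p i.2).
have f_inj : injective f by move=> [a b] [c d] [/perm_inj -> /perm_inj ->].
rewrite /num_occurrences12 -(card_imset _ f_inj); apply: eq_card => -[i j].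
rewrite -[i](permKV p) -[j](permKV p) (mem_imset _ ((p^-1)%g i, (p^-1)%g j) f_inj).
by rewrite !inE /= occurrence12_transpose.
Qed.

Definition rotate_perm n (p : 'S_n) : 'S_n :=
  perm (inj_comp (inj_comp rev_ord_inj (@perm_inj _ p)) rev_ord_inj).

Lemma rotate_permK n : involutive (@rotate_perm n).
Proof. by move=> p; apply/permP => i; rewrite !permE /= !permE /= !rev_ordK. Qed.

(** Reversing both axes maps the grid to itself and exchanges the two points of the pair. *)
Lemma occurrence12_rotate R n (p : 'S_n) i1 i2 :
  occurrence12 (rotate R) (rotate_perm p) (rev_ord i2) (rev_ord i1) =
  occurrence12 R p i1 i2.
Proof.
have E i : rotate_perm p (rev_ord i) = rev_ord (p i).
  by rewrite permE /= rev_ordK.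
have box c k : in_box (rotate_perm p) (rev_ord i2) (rev_ord i1)
   (rev_ord c.1, rev_ord c.2) (rev_ord k) = in_box p i1 i2 c k.
  rewrite /in_box /value !E /pos.
  have := ltn_ord i1; have := ltn_ord i2; have := ltn_ord k.
  have := ltn_ord (p i1); have := ltn_ord (p i2); have := ltn_ord (p k).
  (* Each of the nine boxes is checked separately by linear arithmetic. *)
  by case: c => -[[|[|[|//]]] ?] [[|[|[|//]]] ?]; rewrite /grid /=; lia.
rewrite /occurrence12; congr [&& _, _ & _].
- by rewrite /pos /=; have := ltn_ord i1; have := ltn_ord i2; lia.
- rewrite /value !E /=; have := ltn_ord (p i1); have := ltn_ord (p i2); lia.
apply/forall_inP/forall_inP => H c cR; apply/existsPn => k.
- rewrite -box.
  by move/existsPn: (H (rev_ord c.1, rev_ord c.2)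
    ltac:(by rewrite inE /= !rev_ordK -surjective_pairing)).
- rewrite inE in cR; rewrite -[k]rev_ordK.
  move/existsPn: (H _ cR) => /(_ (rev_ord k)).
  by rewrite -box /= !rev_ordK -surjective_pairing.
Qed.

Lemma equidistributed12_rotate R : equidistributed12 R (rotate R).
Proof.
move=> n k; have rinj := inv_inj (@rotate_permK n).
rewrite /num_perms12 -(card_imset _ rinj).
apply: eq_card => q; rewrite inE -[q]rotate_permK mem_imset //.
rewrite inE; congr (_ == k); set p := rotate_perm q.
pose f (i : 'I_n * 'I_n) := (rev_ord i.2, rev_ord i.1).
have f_inj : injective f.
  by apply: (can_inj (g := f)) => -[a b]; rewrite /f /= !rev_ordK.
rewrite /num_occurrences12 -(card_imset _ f_inj); apply: eq_card => -[i j].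
rewrite -[i]rev_ordK -[j]rev_ordK (mem_imset _ (rev_ord j, rev_ord i) f_inj).
by rewrite !inE /= occurrence12_rotate.
Qed.

(** * Permutations as words *)

Definition word n (p : 'S_n) : seq nat := [seq val (p i) | i <- enum 'I_n].

Lemma nth_word n (p : 'S_n) (i : 'I_n) : nth 0 (word p) i = p i.
Proof. by rewrite (nth_map i) ?size_enum_ord // nth_ord_enum. Qed.

(** Distinct permutations have distinct words, all of them rearrangements of [iota 0 n]; both lists
    have n! members, so the inclusion is an equality. *)
Lemma perm_words n : perm_eq [seq word p | p <- enum 'S_n] (permutations (iota 0 n)).
Proof.
have winj : injective (@word n).
  move=> p q E; apply/permP => i; apply: val_inj.
  by rewrite /= -!nth_word E.
have Uw : uniq [seq word p | p <- enum 'S_n] by rewrite map_inj_uniq // enum_uniq.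
have sub : {subset [seq word p | p <- enum 'S_n] <= permutations (iota 0 n)}.
  move=> _ /mapP[p _ ->]; rewrite mem_permutations uniq_perm ?iota_uniq //.
    by rewrite map_inj_uniq ?enum_uniq // => i j /val_inj/perm_inj.
  move=> x; rewrite mem_iota add0n /=; apply/mapP/idP => [[i _ ->]|ltxn].
    exact: ltn_ord.
  by exists ((p^-1)%g (Ordinal ltxn)); rewrite ?mem_enum // permKV.
have le : size (permutations (iota 0 n)) <= size [seq word p | p <- enum 'S_n].
  by rewrite size_permutations ?iota_uniq // size_iota size_map -cardE card_Sn.
have [_ E] := uniq_min_size Uw sub le.
by apply: uniq_perm; rewrite ?permutations_uniq.
Qed.

Lemma card_words n (P : pred (seq nat)) :
  #|[set p : 'S_n | P (word p)]| = count P (permutations (iota 0 n)).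
Proof.
rewrite -(seq.permP (perm_words n)) count_map -sum1_card -sum1_count big_enum_cond.
by apply: eq_bigl => p; rewrite !inE.
Qed.

(** * The recursion along the running minimum *)

Section RunningMinimum.

Variable good : nat -> nat -> seq nat -> bool.

(* [c] is the running minimum of the entries preceding [w], and [b] tells whether
   the last of these is [c].  [good c h t] tells whether [c, h] is an occurrence
   when [t] lists the entries after [h]. *)
Fixpoint hits (c : nat) (b : bool) (w : seq nat) : nat :=
  if w is h :: t then
    if h < c then hits h true t else (b && good c h t) + hits c false t
  else 0.

(* The number of arrangements with [k] hits of [m] remaining entries, [d] of which
   are below the running minimum. *)
Fixpoint num_hits (m d : nat) (b : bool) (k : nat) : nat :=
  if m is m'.+1 then
    \sum_(r < d) num_hits m' r true k +
    (if b && (d <= m') then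
       (if k is k'.+1 then num_hits m' d false k' else 0) +
       (m' - d) * num_hits m' d false k
     else (m - d) * num_hits m' d false k)
  else k == 0.

Hypothesis good_perm : forall c h t t', perm_eq t t' -> good c h t = good c h t'.
Hypothesis good_unique : forall c s, uniq s -> has (leq c) s ->
  count (fun h => (c <= h) && good c h (rem h s)) s = 1.

(** The rank is strictly increasing on [s], hence injective, and the two lists have the same length.
    This turns a sum over the next minimum into the sum over [r < d] of [num_hits]. *)
Lemma perm_ranks c s : uniq s ->
  perm_eq [seq count (ltn^~ x) s | x <- s & x < c] (iota 0 (count (ltn^~ c) s)).
Proof.
move=> Us.
have lt_rank x y : x \in s -> x < y -> count (ltn^~ x) s < count (ltn^~ y) s.
  move=> xs xy.
  have -> : count (ltn^~ y) s = count (ltn^~ x) s + count (fun z => x <= z < y) s.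
    rewrite -count_predUI -[LHS]addn0; congr (_ + _).
      by apply: eq_count => z /=; lia.
    by apply/esym/eqP; rewrite -leqn0 leqNgt -has_count; apply/hasPn => z _ /=; lia.
  rewrite -[X in X < _]addn0 ltn_add2l -has_count; apply/hasP; exists x => //=; lia.
have Ur : uniq [seq count (ltn^~ x) s | x <- s & x < c].
  rewrite map_inj_in_uniq ?filter_uniq // => x y.
  rewrite !mem_filter => /andP[_ xs] /andP[_ ys] E.
  by case: (ltngtP x y) => // /lt_rank; rewrite ?xs ?ys E ltnn => /(_ isT).
have sub : {subset [seq count (ltn^~ x) s | x <- s & x < c] <=
            iota 0 (count (ltn^~ c) s)}.
  move=> r /mapP[x]; rewrite mem_filter => /andP[xc xs] ->.
  by rewrite mem_iota add0n /= lt_rank.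
have le : size (iota 0 (count (ltn^~ c) s)) <=
          size [seq count (ltn^~ x) s | x <- s & x < c].
  by rewrite size_iota size_map size_filter.
have [_ E] := uniq_min_size Ur sub le.
by apply: uniq_perm; rewrite ?iota_uniq.
Qed.

Lemma count_permutations (P : pred (seq nat)) s : uniq s -> 0 < size s ->
  count P (permutations s) =
  \sum_(x <- s) count (fun t => P (x :: t)) (permutations (rem x s)).
Proof.
move=> Us s0; rewrite (seq.permP (permutationsE s0)) undup_id // count_flatten.
rewrite sumnE !big_map; by apply: eq_bigr => x _; rewrite count_map.
Qed.

(** Classify by the first entry. By [good_perm] its being good depends only on the set of later
    entries, and by [good_unique] exactly one candidate is good, so nothing else about [good]
    affects the count. *)
Lemma count_hits s c b k : uniq s ->
  count (fun w => hits c b w == k) (permutations s) =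
  num_hits (size s) (count (ltn^~ c) s) b k.
Proof.
(* Induction on a bound for the size: what remains after a choice is [rem x s], not a tail of
   [s]. *)
elim: {s}_.+1 {-2}s (ltnSn (size s)) c b k => // m IHm s ltsm c b k Us.
case Es: (size s) => [|m'].
  by move/size0nil: Es => -> /=; rewrite addn0 eq_sym.
rewrite count_permutations ?Es // (bigID (ltn^~ c)) /=.
have size_rem_s x : x \in s -> size (rem x s) = m'.
  by move=> xs; rewrite size_rem // Es.
have ltm x : x \in s -> size (rem x s) < m by move=> xs; rewrite size_rem_s //; lia.
congr (_ + _).
  (* First entries below [c]: such an [x] becomes the minimum, and its rank in [s] is the new
     [d]. *)
  rewrite -(big_mkord xpredT (fun r => num_hits m' r true k)) /index_iota subn0.
  rewrite -(perm_big _ (perm_ranks c Us)) big_map big_filter.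
  rewrite big_seq_cond [RHS]big_seq_cond; apply: eq_bigr => x /andP[xs xc].
  rewrite -(size_rem_s x xs).
  have -> : count (ltn^~ x) s = count (ltn^~ x) (rem x s).
    by rewrite count_rem /= ltnn andbF subn0.
  by rewrite -IHm ?rem_uniq ?ltm //; apply: eq_count => t /=; rewrite xc.
set d := count _ s.
(* A good first entry uses up one hit, which is impossible when [k] is 0. *)
pose A := if k is k'.+1 then num_hits m' d false k' else 0.
have term x : x \in s -> ~~ (x < c) ->
    count (fun t => hits c b (x :: t) == k) (permutations (rem x s)) =
    if b && good c x (rem x s) then A else num_hits m' d false k.
  move=> xs xc; have Ed : d = count (ltn^~ c) (rem x s).
    by rewrite count_rem /= (negbTE xc) andbF subn0.
  have -> : count (fun t => hits c b (x :: t) == k) (permutations (rem x s)) =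
    count (fun t => (b && good c x (rem x s)) + hits c false t == k)
      (permutations (rem x s)).
    apply: eq_in_count => t; rewrite mem_permutations => /good_perm E.
    by rewrite /= (negbTE xc) E.
  rewrite Ed -(size_rem_s x xs); case: (b && _) => /=; last first.
    by rewrite -IHm ?rem_uniq ?ltm //.
  rewrite /A Ed -(size_rem_s x xs); case: (k) => [|k'].
    by apply/eqP; rewrite -leqn0 leqNgt -has_count; apply/hasPn => t _ /=.
  by rewrite -IHm ?rem_uniq ?ltm //.
have Ecd : count (fun x => ~~ (x < c)) s = m'.+1 - d.
  by rewrite -Es -(count_predC (ltn^~ c) s) addKn; apply: eq_count.
rewrite big_seq_cond (eq_bigr (fun x => if b && good c x (rem x s) then A
  else num_hits m' d false k)); last by move=> x /andP[]; apply: term.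
rewrite -big_seq_cond (bigID (fun x => b && good c x (rem x s))) /=.
rewrite (eq_bigr (fun=> A)); last by move=> x /andP[_ ->].
rewrite [X in _ + X](eq_bigr (fun=> num_hits m' d false k)); last first.
  by move=> x /andP[_ /negbTE ->].
rewrite !big_const_seq !iter_addn !addn0.
case: b {term} => /=; last first.
  rewrite (eq_count (a2 := pred0)) ?count_pred0 ?muln0 => [|x]; last by rewrite andbF.
  rewrite add0n mulnC; congr (_ * _); rewrite -Ecd; apply: eq_count => x.
  by rewrite andbT.
(* If [d > m'], no entry is at least [c], and what remains on both sides is 0. *)
have [ledm|gtdm] := leqP d m'; last first.
  have z (Q : pred nat) : count (fun x => ~~ (x < c) && Q x) s = 0.
    apply/eqP; rewrite -leqn0; apply: (leq_trans (sub_count _ s)).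
      by move=> x /andP[h _]; exact: h.
    by rewrite Ecd leqn0 subn_eq0.
  by rewrite !z !muln0; move: gtdm; rewrite -subn_eq0 => /eqP ->.
(* One of the [m'.+1 - d] entries that are at least [c] is good, which leaves [m' - d] others. *)
have C1 : count (fun x => ~~ (x < c) && good c x (rem x s)) s = 1.
  rewrite -(good_unique (c := c) Us).
    by apply: eq_count => x; rewrite -leqNgt.
  rewrite has_count (eq_count (a2 := fun x => ~~ (x < c))) => [|x].
    by rewrite Ecd subn_gt0.
  by rewrite -leqNgt.
rewrite C1 muln1 mulnC; congr (_ + _ * _).
have : count (fun x => ~~ (x < c) && good c x (rem x s)) s +
  count (fun x => ~~ (x < c) && ~~ good c x (rem x s)) s =
  count (fun x => ~~ (x < c)) s.
  rewrite -count_predUI -[RHS]addn0; congr (_ + _).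
    by apply: eq_count => x /=; case: (x < c) => //=; case: good.
  apply/eqP; rewrite -leqn0 leqNgt -has_count; apply/hasPn => x _ /=.
  by case: good; rewrite !andbF.
rewrite C1 Ecd; lia.
Qed.

(** Unrolls the recursion into a count over positions. The start [a] is general for the induction.
    The running minimum [c] is specified only by its comparison with values below [N], so that for
    [a = 0] any [c >= N] serves as the minimum of no entries. *)
Lemma hits_map_iota (v : nat -> nat) N a m c b :
  {in gtn (a + m) &, injective v} ->
  (forall j, j < a + m -> v j < N) ->
  (forall x, x < N -> (x < c) = all (fun i => x < v i) (iota 0 a)) ->
  b = (0 < a) && all (fun i => v a.-1 <= v i) (iota 0 a) ->
  (b -> c = v a.-1) ->
  hits c b [seq v j | j <- iota a m] =
  count (fun j => [&& 0 < j, all (fun i => v j.-1 <= v i) (iota 0 j),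
                      v j.-1 < v j &
                      good (v j.-1) (v j) [seq v i | i <- iota j.+1 (a + m - j.+1)]])
        (iota a m).
Proof.
elim: m a c b => [//|m IHm] a c b vinj vN cP bP bc.
have am : a < a + m.+1 by rewrite addnS ltnS leq_addr.
have iotaS : iota 0 a.+1 = rcons (iota 0 a) a.
  by rewrite -cats1 -addn1 iotaD.
rewrite /= -/(hits _ _ _).
have tl : a + m.+1 - a.+1 = m by lia.
rewrite tl andbA -bP.
have [hc|hc] := boolP (v a < c).
  have va := hc; rewrite cP ?vN // in va.
  rewrite (IHm a.+1) ?addSnnS //; last first.
  - by rewrite iotaS all_rcons /= leqnn; apply/esym/allP => i /(allP va)/ltnW.
  - move=> x xN; rewrite iotaS all_rcons; have [xa|//] := ltnP.
    apply/esym/allP => i /(allP va); lia.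
  (* When [b] holds, [v a < c] gives a descent at [a], so this position contributes nothing. *)
  have -> : [&& b, v a.-1 < v a & good (v a.-1) (v a) [seq v i | i <- iota a.+1 m]]
     = false.
    apply/negbTE/negP => /and3P[]; rewrite {1}bP => /andP[a0 _].
    have /(allP va) : a.-1 \in iota 0 a by rewrite mem_iota; lia.
    lia.
  by rewrite add0n.
(* Here some earlier entry is at most [v a], and strictly smaller by injectivity, so the flag
   becomes [false]. *)
rewrite (IHm a.+1) ?addSnnS //; last first.
- rewrite iotaS all_rcons /= leqnn /=; apply/esym/negbTE.
  move: (hc); rewrite cP ?vN // => /allPn[i].
  rewrite mem_iota /= add0n => ia vi; apply/allPn; exists i; first by rewrite mem_iota.
  have : v a <> v i by move/vinj; rewrite !inE => E; have := E am ltac:(lia); lia.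
  lia.
- move=> x xN; rewrite iotaS all_rcons -cP //; lia.
(* If [b] holds, then [c = v a.-1], and the ascent follows from [~~ (v a < c)] and injectivity. *)
congr (nat_of_bool _ + _); case: b bP bc => //= bP /(_ isT) Ec.
rewrite -Ec; suff -> : c < v a by [].
have a0 : 0 < a by case: (0 < a) bP.
have : v a <> v a.-1 by move/vinj; rewrite !inE => E; have := E am ltac:(lia); lia.
lia.
Qed.

End RunningMinimum.

(** * The two choices of the completing entry *)

Definition below_rest (c h : nat) (t : seq nat) := all (fun y => (y < c) || (h < y)) t.
(** Entries below [c] are also below [h] when [c <= h], so being greatest among the larger later
    entries means exceeding all later entries. *)
Definition above_rest (c h : nat) (t : seq nat) := all (fun y => y < h) t.

Lemma count_unique (T : eqType) (P : pred T) s x :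
  uniq s -> x \in s -> P x -> {in s, forall y, P y -> y = x} -> count P s = 1.
Proof.
move=> Us xs Px Ex; transitivity (count_mem x s); last by rewrite count_uniq_mem // xs.
apply: eq_in_count => y ys /=; apply/idP/eqP => [/Ex->//|->//].
Qed.

(** The one entry is the least member of [s] that is at least [c]. *)
Lemma below_rest_unique c s : uniq s -> has (leq c) s ->
  count (fun h => (c <= h) && below_rest c h (rem h s)) s = 1.
Proof.
move=> Us hs; have ex : exists x, (x \in s) && (c <= x).
  by case/hasP: hs => x xs cx; exists x; rewrite xs.
case: (ex_minnP ex) => x /andP[xs cx] xmin.
apply: (count_unique Us xs).
  rewrite cx; apply/allP => y; rewrite mem_rem_uniq // !inE => /andP[yx ys].
  by case: ltnP => //= cy; have := xmin y; rewrite ys cy => /(_ isT); lia.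
move=> y ys /andP[cy /allP/(_ x)]; rewrite mem_rem_uniq // !inE xs andbT.
have := xmin y; rewrite ys cy => /(_ isT) xy.
by case: eqP => // ? /(_ isT); lia.
Qed.

(** The one entry is the maximum of [s], which is at least [c]. *)
Lemma above_rest_unique c s : uniq s -> has (leq c) s ->
  count (fun h => (c <= h) && above_rest c h (rem h s)) s = 1.
Proof.
move=> Us hs; have ex : exists x, (x \in s) && (c <= x).
  by case/hasP: hs => x xs cx; exists x; rewrite xs.
have bd x : (x \in s) && (c <= x) -> x <= \max_(y <- s) y.
  by move=> /andP[xs _]; exact: leq_bigmax_seq.
case: (ex_maxnP ex bd) => x /andP[xs cx] xmax.
apply: (count_unique Us xs).
  rewrite cx; apply/allP => y; rewrite mem_rem_uniq // !inE => /andP[yx ys].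
  by have := xmax y; rewrite ys /=; lia.
move=> y ys /andP[cy /allP/(_ x)]; rewrite mem_rem_uniq // !inE xs andbT.
have := xmax y; rewrite ys cy => /(_ isT) xy.
by case: eqP => // ? /(_ isT); lia.
Qed.

(** * From occurrences to hits *)

Lemma occurrence12_shadingP l n (p : 'S_n) (i1 i2 : 'I_n) :
  all (fun c => (c.1 < 3) && (c.2 < 3)) l ->
  reflect [/\ i1 < i2, p i1 < p i2 & forall (k : 'I_n) a b, (a, b) \in l ->
     ~ ((grid n i1.+1 i2.+1 a < k.+1 < grid n i1.+1 i2.+1 a.+1) &&
       (grid n (p i1).+1 (p i2).+1 b < (p k).+1 < grid n (p i1).+1 (p i2).+1 b.+1))]
  (occurrence12 (shading l) p i1 i2).
Proof.
move=> /allP l3; apply: (iffP and3P) => -[i12 p12 H]; split => //.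
  move=> k a b abl; have /andP[a3 b3] := l3 _ abl.
  move/forall_inP: H => /(_ (Ordinal a3, Ordinal b3)); rewrite inE abl => /(_ isT).
  by move/existsPn/(_ k)/negP.
apply/forall_inP => c; rewrite inE => cl; apply/existsPn => k; apply/negP.
exact: H cl.
Qed.

(** The condition counted in [hits_map_iota]; [j] is the position of the larger entry of the
    pair. *)
Definition hit (good : nat -> nat -> seq nat -> bool) (w : seq nat) (j : nat) :=
  let v := nth 0 w in
  [&& 0 < j, all (fun i => v j.-1 <= v i) (iota 0 j), v j.-1 < v j &
      good (v j.-1) (v j) [seq v i | i <- iota j.+1 (size w - j.+1)]].

Lemma num_occurrences12_hits R good n (p : 'S_n) :
  (forall i1 i2 : 'I_n, occurrence12 R p i1 i2 =
     (i2 == i1.+1 :> nat) && hit good (word p) i2) ->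
  num_occurrences12 R p = hits good n false (word p).
Proof.
move=> occE; have szw : size (word p) = n by rewrite size_map size_enum_ord.
rewrite -[X in hits _ _ _ X](mkseq_nth 0) szw /mkseq.
(* The starting value [n] exceeds every entry and acts as an infinite minimum. *)
rewrite (@hits_map_iota good (nth 0 (word p)) n) ?add0n //; first last.
- by move=> j jn; have /= -> := nth_word p (Ordinal jn); exact: ltn_ord.
- move=> i j; rewrite !inE => hi hj.
  have /= -> := nth_word p (Ordinal hi); have /= -> := nth_word p (Ordinal hj).
  by move/val_inj/perm_inj/(congr1 val).
rewrite /num_occurrences12 -val_enum_ord count_map -size_filter.
set P := (X in filter X _); have hitE (j : 'I_n) : P j = hit good (word p) j.
  by rewrite /P /= /hit szw.
have -> : size (filter P (enum 'I_n)) = #|[set j : 'I_n | hit good (word p) j]|.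
  rewrite size_filter -sum1_card -sum1_count big_enum_cond.
  by apply: eq_bigl => j; rewrite !inE hitE.
(* The two positions are adjacent, so the second one determines the occurrence. *)
rewrite -(card_in_imset (f := snd)).
  apply: eq_card => j; rewrite inE; apply/imsetP/idP.
    by case=> -[i1 i2]; rewrite inE /= occE => /andP[_ h] ->.
  move=> h; have j0 : 0 < j by case/and4P: h.
  have ltj : j.-1 < n by have := ltn_ord j; lia.
  by exists (Ordinal ltj, j) => //; rewrite inE /= occE h andbT /= prednK.
move=> [i1 i2] [j1 j2]; rewrite !inE /= !occE => /andP[/eqP E _] /andP[/eqP E' _] E2.
by rewrite E2 in E *; congr pair; apply: val_inj => /=; lia.
Qed.

(** The two shadings differ in one box: (2, 1) forbids later entries between the two values, (2, 2)
    later entries above both. *)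
Definition low_shading := shading [:: (1, 2); (1, 1); (2, 1); (0, 0); (1, 0)].
Definition high_shading := shading [:: (1, 2); (2, 2); (1, 1); (0, 0); (1, 0)].

Lemma hitP (good : nat -> nat -> seq nat -> bool) n (p : 'S_n) (j1 j2 : 'I_n) :
  (j2 = j1.+1 :> nat) ->
  reflect [/\ forall i : 'I_n, i < j1 -> p j1 < p i, p j1 < p j2
    & good (p j1) (p j2) (map (nth 0 (word p)) (iota j2.+1 (n - j2.+1)))]
  (hit good (word p) j2).
Proof.
move=> E; have -> : hit good (word p) j2 =
  [&& all (fun i => p j1 <= nth 0 (word p) i) (iota 0 j2), p j1 < p j2 &
    good (p j1) (p j2) (map (nth 0 (word p)) (iota j2.+1 (n - j2.+1)))].
  by rewrite /hit size_map size_enum_ord E /= !nth_word -E nth_word.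
apply: (iffP and3P) => -[H ? ?]; split => //.
  move=> i ij; move/allP: H => /(_ i); rewrite mem_iota nth_word add0n.
  have : p i != p j1 by apply/eqP => /perm_inj Ei; rewrite Ei ltnn in ij.
  by rewrite -val_eqE /= => ? /(_ ltac:(lia)); lia.
apply/allP => i; rewrite mem_iota add0n /= E => ij.
have ltin : i < n by have := ltn_ord j1; lia.
have /= -> := nth_word p (Ordinal ltin).
have [ij1|] := ltnP i j1; first exact/ltnW/H.
by move=> ji; rewrite (_ : Ordinal ltin = j1) //; apply: val_inj => /=; lia.
Qed.

Lemma all_rest n (p : 'S_n) (P : pred nat) (j : nat) :
  reflect (forall k : 'I_n, j <= k -> P (p k))
    (all P (map (nth 0 (word p)) (iota j (n - j)))).
Proof.
rewrite all_map; apply: (iffP allP) => [H k jk|H k].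
  by have := H k; rewrite /= nth_word; apply; rewrite mem_iota; have := ltn_ord k; lia.
rewrite mem_iota => /andP[jk kn]; have ltkn : k < n by lia.
by have /= -> := nth_word p (Ordinal ltkn); apply: H.
Qed.

Lemma perm_val_neq n (p : 'S_n) (k l : 'I_n) : k != l :> nat -> p k != p l :> nat.
Proof. by apply: contraNneq => /val_inj/perm_inj ->. Qed.

(** Otherwise the entry at position [i.+1] lies strictly between the two columns, and its value
    avoids both rows, so it falls into a box of the shaded middle column. *)
Lemma occurrence12_adjacent l n (p : 'S_n) (i j : 'I_n) :
  all (fun c => (c.1 < 3) && (c.2 < 3)) l ->
  all [in l] [:: (1, 0); (1, 1); (1, 2)] ->
  occurrence12 (shading l) p i j -> j = i.+1 :> nat.
Proof.
move=> l3 /and4P[l0 l1 l2 _] /(occurrence12_shadingP _ _ _ l3)[ij pij H].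
apply/eqP; apply: contraT => neqj.
have lt : i.+1 < n by have := ltn_ord j; lia.
have := H (Ordinal lt) _ _ l0; have := H (Ordinal lt) _ _ l1.
have := H (Ordinal lt) _ _ l2.
have := @perm_val_neq _ p (Ordinal lt) i; have := @perm_val_neq _ p (Ordinal lt) j.
by have := ltn_ord (p (Ordinal lt)); rewrite /grid /=; lia.
Qed.

(** The middle column amounts to adjacency, (0, 0) to [p i] being a left-to-right minimum, and (2,
    1) to [below_rest]. *)
Lemma occurrence12_low n (p : 'S_n) (i j : 'I_n) :
  occurrence12 low_shading p i j =
  (j == i.+1 :> nat) && hit below_rest (word p) j.
Proof.
apply/idP/andP => [occ|[/eqP ij /(hitP _ _ ij)[H pij /all_rest G]]].
  have E : j = i.+1 :> nat by apply: (occurrence12_adjacent _ _ occ).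
  case/occurrence12_shadingP: occ => // ij pij H.
  split; first exact/eqP.
  apply/(hitP _ _ E); split=> // [k ki|].
    by have := H k 0 0 isT; have := @perm_val_neq _ p k i; rewrite /grid /=; lia.
  apply/all_rest => k jk; have := H k 2 1 isT.
  have := @perm_val_neq _ p k i; have := @perm_val_neq _ p k j.
  by rewrite /grid /=; have := ltn_ord k; have := ltn_ord (p k); lia.
apply/occurrence12_shadingP => //; split=> // [|k a b]; first by rewrite ij.
have := H k; have := G k; have := ltn_ord k; have := ltn_ord (p k).
rewrite !inE !xpair_eqE /grid.
by case: a => [|[|[|a]]]; case: b => [|[|[|b]]] //=; lia.
Qed.

(** As for [low_shading], with (2, 2) giving [above_rest]. *)
Lemma occurrence12_high n (p : 'S_n) (i j : 'I_n) :
  occurrence12 high_shading p i j =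
  (j == i.+1 :> nat) && hit above_rest (word p) j.
Proof.
apply/idP/andP => [occ|[/eqP ij /(hitP _ _ ij)[H pij /all_rest G]]].
  have E : j = i.+1 :> nat by apply: (occurrence12_adjacent _ _ occ).
  case/occurrence12_shadingP: occ => // ij pij H.
  split; first exact/eqP.
  apply/(hitP _ _ E); split=> // [k ki|].
    by have := H k 0 0 isT; have := @perm_val_neq _ p k i; rewrite /grid /=; lia.
  apply/all_rest => k jk; have := H k 2 2 isT.
  have := @perm_val_neq _ p k i; have := @perm_val_neq _ p k j.
  by rewrite /grid /=; have := ltn_ord k; have := ltn_ord (p k); lia.
apply/occurrence12_shadingP => //; split=> // [|k a b]; first by rewrite ij.
have := H k; have := G k; have := ltn_ord k; have := ltn_ord (p k).
rewrite !inE !xpair_eqE /grid.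
by case: a => [|[|[|a]]]; case: b => [|[|[|b]]] //=; lia.
Qed.

(** * Equidistribution *)

Lemma num_perms12_hits R good n k :
  (forall c h t t', perm_eq t t' -> good c h t = good c h t') ->
  (forall c s, uniq s -> has (leq c) s ->
     count (fun h => (c <= h) && good c h (rem h s)) s = 1) ->
  (forall (p : 'S_n) (i j : 'I_n), occurrence12 R p i j =
     (j == i.+1 :> nat) && hit good (word p) j) ->
  num_perms12 R n k = num_hits n n false k.
Proof.
move=> gperm guniq occE.
have -> : num_perms12 R n k =
    #|[set p : 'S_n | (fun w => hits good n false w == k) (word p)]|.
  apply: eq_card => p; rewrite !inE.
  by rewrite (num_occurrences12_hits (good := good)).
rewrite (card_words n (fun w => hits good n false w == k)).
(* Initially all [n] entries lie below the running minimum [n], so [d = n]. *)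
rewrite count_hits ?iota_uniq // size_iota; congr num_hits.
apply/eqP; rewrite -[X in _ == X](size_iota 0 n) -all_count.
by apply/allP => x; rewrite mem_iota.
Qed.

Lemma equidistributed12_low_high : equidistributed12 low_shading high_shading.
Proof.
move=> n k; rewrite (num_perms12_hits k _ below_rest_unique (@occurrence12_low n)).
  rewrite (num_perms12_hits k _ above_rest_unique (@occurrence12_high n)) //.
  by move=> c h t t'; apply: perm_all.
by move=> c h t t'; apply: perm_all.
Qed.

Theorem theorem6p1 (R1 R2 : {set 'I_3 * 'I_3}) :
  let patterns : seq {set 'I_3 * 'I_3} :=
    [:: shading [:: (1, 2); (0, 1); (1, 1); (2, 1); (0, 0)];
        shading [:: (1, 2); (2, 2); (0, 1); (1, 1); (1, 0)];
        shading [:: (2, 2); (0, 1); (1, 1); (2, 1); (1, 0)];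
        shading [:: (1, 2); (1, 1); (2, 1); (0, 0); (1, 0)];
        shading [:: (2, 2); (0, 1); (1, 1); (2, 1); (0, 0)];
        shading [:: (1, 2); (2, 2); (1, 1); (0, 0); (1, 0)]] in
  R1 \in patterns -> R2 \in patterns -> equidistributed12 R1 R2.
Proof.
move=> patterns.
(* Every pattern is [low_shading] or [high_shading] up to the symmetries, so [low_shading] serves as
   the common reference. *)
have eq_low R : R \in patterns -> equidistributed12 low_shading R.
  have Et : transpose low_shading = shading [:: (1, 2); (0, 1); (1, 1); (2, 1); (0, 0)].
    by apply/setP => -[[[|[|[|//]]] ?] [[|[|[|//]]] ?]]; rewrite !inE.
  have Er : rotate low_shading = shading [:: (1, 2); (2, 2); (0, 1); (1, 1); (1, 0)].
    by apply/setP => -[[[|[|[|//]]] ?] [[|[|[|//]]] ?]]; rewrite !inE.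
  have Etr : rotate (transpose low_shading) =
             shading [:: (2, 2); (0, 1); (1, 1); (2, 1); (1, 0)].
    by apply/setP => -[[[|[|[|//]]] ?] [[|[|[|//]]] ?]]; rewrite !inE.
  have Eh : transpose high_shading = shading [:: (2, 2); (0, 1); (1, 1); (2, 1); (0, 0)].
    by apply/setP => -[[[|[|[|//]]] ?] [[|[|[|//]]] ?]]; rewrite !inE.
  rewrite !inE -Et -Er -Etr -Eh -/low_shading -/high_shading.
  have := equidistributed12_transpose; have := equidistributed12_rotate.
  have := equidistributed12_low_high.
  rewrite /equidistributed12 => LH rot tr.
  by do 5?[case/orP]; move=> /eqP -> n k; rewrite -?rot -?tr -?LH.
by move=> /eq_low E1 /eq_low E2 n k; rewrite -E1 E2.
Qed.
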